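(* Let $A$ be an abelian group and $T = \mathrm{Th}(A; +)$. Then $T$ is dp-small if and only if $T$ is dp-minimal and $A$ is upwardly coherent.
   Context: For a complete theory $T$ in language $L$ with monster model $\mathcal{U}$ ($\mathcal{U}_y$ the $|y|$-tuples from $\mathcal{U}$): a partial type $\pi(x)$ is dp-small if there do not exist $L(\mathcal{U})$-formulas $\varphi_i(x)$ ($i<\omega$), an $L$-formula $\psi(x;y)$ and $b_j\in\mathcal{U}_y$ ($j<\omega$) such that for all $i_0,j_0<\omega$ the type $\pi(x)\cup\{\varphi_{i_0}(x),\psi(x;b_{j_0})\}\cup\{\neg\varphi_i(x): i\ne i_0\}\cup\{\neg\psi(x;b_j): j\neq j_0\}$ is consistent. $T$ is dp-minimal if there do not exist $L$-formulas $\varphi(x;y),\psi(x;z)$, $a_i\in\mathcal{U}_y$, $b_j\in\mathcal{U}_z$ ($i,j<\omega$) such that for all $i_0,j_0$ the set $\{\varphi(x;a_{i_0}),\psi(x;b_{j_0})\}\cup\{\neg\varphi(x;a_i):i\ne i_0\}\cup\{\neg\psi(x;b_j):j\ne j_0\}$ is consistent. In both cases $x$ is a single variable. For definable subgroups $B_0,B_1$ of $A$, write $B_0\precsim B_1$ iff $[B_0:B_0\cap B_1]<\aleph_0$; let $\sim$ be the induced equivalence relation. $\mathrm{PP}(A)$ is the set of p.p.-definable subgroups of $A$, i.e. finite intersections of subgroups $\{x\in A: \exists y\,(k y = m x)\}$ for integers $k,m$, and $\widetilde{\mathrm{PP}}(A)=\mathrm{PP}(A)/\sim$, partially ordered by $\precsim$.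 A class $X\in\widetilde{\mathrm{PP}}(A)$ is upwardly coherent if there is $B\in X$ such that for all $B_1\in\mathrm{PP}(A)$ with $B\precsim B_1$ and not $B_1 \precsim B$, we have $B\subseteq B_1$. $A$ is upwardly coherent if every $X\in\widetilde{\mathrm{PP}}(A)$ is upwardly coherent. *)

(* Defs.v *)
From HB Require Import structures.
From mathcomp Require Import all_boot all_order all_algebra.
Set Implicit Arguments. Unset Strict Implicit. Unset Printing Implicit Defensive.
Import GRing.Theory.
Local Open Scope ring_scope.

Inductive term : Type :=
| TVar : nat -> term
| TAdd : term -> term -> term.

Inductive formula : Type :=
| FEq  : term -> term -> formula
| FNeg : formula -> formula
| FAnd : formula -> formula -> formula
| FEx  : nat -> formula -> formula.

Definition upd (M : zmodType) (e : nat -> M) (n : nat) (b : M) : nat -> M :=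
  fun k => if k == n then b else e k.

Fixpoint teval (M : zmodType) (e : nat -> M) (t : term) : M :=
  match t with
  | TVar n => e n
  | TAdd t1 t2 => teval e t1 + teval e t2
  end.

Fixpoint sat (M : zmodType) (e : nat -> M) (f : formula) : Prop :=
  match f with
  | FEq t1 t2 => teval e t1 = teval e t2
  | FNeg g => ~ sat e g
  | FAnd g h => sat e g /\ sat e h
  | FEx n g => exists b : M, sat (upd e n b) g
  end.

(* M |= the universal closure of f.  Since structures are nonempty, agreement on
   all universal closures is exactly elementary equivalence (M, +) == (N, +). *)
Definition valid (M : zmodType) (f : formula) : Prop := forall e : nat -> M, sat e f.

Definition elem_equiv (M N : zmodType) : Prop :=
  forall f : formula, valid M f <-> valid N f.

(* Convention: a formula phi(x; y) has object variable x := variable 0; a tuple of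
   parameters is given as an environment c : nat -> M (value at 0 is ignored).
   phi(a; c) is  sat (upd c 0 a) phi. *)
Definition inst (M : zmodType) (phi : formula) (c : nat -> M) (a : M) : Prop :=
  sat (upd c 0 a) phi.

(* Consistency of a (partial) type over parameters of the monster model of
   T = Th(A; +) is rendered as realizability in some model M of T, i.e. some
   M with (M;+) elementarily equivalent to (A;+).  *)

Definition dp_minimal (A : zmodType) : Prop :=
  ~ exists (M : zmodType) (phi psi : formula)
           (a : nat -> nat -> M) (b : nat -> nat -> M),
      elem_equiv A M /\
      forall i0 j0 : nat, exists x : M,
        [/\ inst phi (a i0) x, inst psi (b j0) x,
            (forall i, i <> i0 -> ~ inst phi (a i) x) &
            (forall j, j <> j0 -> ~ inst psi (b j) x)].

(* T is dp-small, i.e. the partial type {x = x} is dp-small: the L(U)-formulas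
   phi_i(x) are theta_i(x; c_i) with theta_i an L-formula and c_i parameters. *)
Definition dp_small (A : zmodType) : Prop :=
  ~ exists (M : zmodType) (theta : nat -> formula) (c : nat -> nat -> M)
           (psi : formula) (b : nat -> nat -> M),
      elem_equiv A M /\
      forall i0 j0 : nat, exists x : M,
        [/\ inst (theta i0) (c i0) x, inst psi (b j0) x,
            (forall i, i <> i0 -> ~ inst (theta i) (c i) x) &
            (forall j, j <> j0 -> ~ inst psi (b j) x)].

Definition pp_of (A : zmodType) (s : seq (int * int)) : A -> Prop :=
  fun x => forall km, km \in s -> exists y : A, y *~ km.1 = x *~ km.2.

Definition is_pp (A : zmodType) (B : A -> Prop) : Prop :=
  exists s : seq (int * int), forall x, B x <-> pp_of s x.

(* B0 <~ B1 iff [B0 : B0 /\ B1] is finite: B0 is covered by finitely many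
   cosets of B0 /\ B1. *)
Definition precsim (A : zmodType) (B0 B1 : A -> Prop) : Prop :=
  exists s : seq A, (forall g, g \in s -> B0 g) /\
    forall x, B0 x -> exists2 g, g \in s & (B0 (x - g) /\ B1 (x - g)).

Definition simeq (A : zmodType) (B0 B1 : A -> Prop) : Prop :=
  precsim B0 B1 /\ precsim B1 B0.

Definition class_upwardly_coherent (A : zmodType) (B' : A -> Prop) : Prop :=
  exists B : A -> Prop, [/\ is_pp B, simeq B B' &
    forall B1 : A -> Prop, is_pp B1 -> precsim B B1 -> ~ precsim B1 B ->
      forall x, B x -> B1 x].

Definition upwardly_coherent (A : zmodType) : Prop :=
  forall B' : A -> Prop, is_pp B' -> class_upwardly_coherent B'.

(* Main.v *)
(* In an abelian group every formula is a Boolean combination of p.p. formulas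
   (Baur-Monk), so a formula in one variable with parameters defines a Boolean
   combination of cosets of p.p.-definable subgroups, and dp-minimality makes
   [precsim] total on these subgroups.

   If the class of B is not upwardly coherent, iterated failures of coherence give
   subgroups C_0 > C_1 > C_2 > ... that are all infinite modulo B, with witnesses
   x_i in B, C_i \ C_{i+1}. The layers C_i \ C_{i+1} against the cosets of B by
   elements of C_N form the first N rows of a forbidden pattern for every N, hence
   an ultrapower contains an infinite one.

   Conversely, let x_{ij} realize a pattern of theta_i and psi(x; b_j), and fix a
   free ultrafilter on the columns j. Only boundedly many cosets occur in
   psi(x; b_j), so for almost all j two rows i, i' have x_{ij} and x_{i'j} in a common
   coset of one subgroup K for which row i leaves every K-coset. By coherence K can
   be shrunk so that each p.p. subgroup L contains K or satisfies L <~ K. In the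
   first case L does not separate x_{ij} from x_{i'j}; in the second its cosets are
   met by neither for almost all j. So theta_i cannot separate them. *)
From HB Require Import structures.
Require Import Defs.
From mathcomp Require Import all_boot all_order all_algebra.
From mathcomp Require Import boolp classical_sets functions filter.

Set Implicit Arguments.
Unset Strict Implicit.
Unset Printing Implicit Defensive.
Import GRing.Theory.
Local Open Scope ring_scope.

(** * Positive primitive formulas *)

Section LinearForms.
Variable M : zmodType.
Implicit Types (e : nat -> M) (p : {poly int}).

(** An integer linear form is stored as a polynomial: the coefficient of ['X^i] multiplies variable
    [i], so finite support and linear algebra come from [{poly int}]. *)
Definition lin p e : M := \sum_(i < size p) e i *~ p`_i.

Lemma lin_widen n p e : (size p <= n)%N -> lin p e = \sum_(i < n) e i *~ p`_i.
Proof.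
move=> le_pn; rewrite /lin -(subnKC le_pn) big_split_ord /=.
rewrite [X in _ + X]big1 ?addr0 // => i _.
by rewrite nth_default ?mulr0z // leq_addr.
Qed.

Lemma linD p q e : lin (p + q) e = lin p e + lin q e.
Proof.
rewrite !(@lin_widen (maxn (size p) (size q))) ?leq_maxl ?leq_maxr ?size_polyD //.
by rewrite -big_split; apply: eq_bigr => i _; rewrite coefD mulrzDr.
Qed.

Lemma lin0 e : lin 0 e = 0.
Proof. by rewrite /lin size_poly0 big_ord0. Qed.

Lemma linZ c p e : lin (c *: p) e = lin p e *~ c.
Proof.
rewrite (@lin_widen (size p)) ?size_scale_leq // /lin mulrz_suml.
by apply: eq_bigr => i _; rewrite coefZ mulrC mulrzA.
Qed.

Lemma linN p e : lin (- p) e = - lin p e.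
Proof. by rewrite -scaleN1r linZ mulrNz mulr1z. Qed.

Lemma linB p q e : lin (p - q) e = lin p e - lin q e.
Proof. by rewrite linD linN. Qed.

Lemma lin_sum (I : finType) (P : I -> {poly int}) e :
  lin (\sum_i P i) e = \sum_i lin (P i) e.
Proof.
by rewrite (big_morph (fun p => lin p e) (id1 := 0) (op1 := +%R)) ?lin0 // => x y; exact: linD.
Qed.

Lemma linX n e : lin 'X^n e = e n.
Proof.
rewrite /lin size_polyXn big_ord_recr /= coefXn eqxx mulr1z big1 ?add0r // => i _.
by rewrite coefXn ltn_eqF ?mulr0z.
Qed.

Lemma lin_eq p e e' : (forall i, (i < size p)%N -> e i = e' i) -> lin p e = lin p e'.
Proof. by move=> ee'; apply: eq_bigr => i _; rewrite ee'. Qed.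

Lemma lin_envB p e e' : lin p (fun i => e i - e' i) = lin p e - lin p e'.
Proof.
by rewrite /lin -sumrB; apply: eq_bigr => i _; rewrite mulrzBl.
Qed.

Lemma lin_upd p e n b : lin p (upd e n b) = lin p (upd e n 0) + b *~ p`_n.
Proof.
have le_pn : (size p <= maxn (size p) n.+1)%N by exact: leq_maxl.
have lt_n : (n < maxn (size p) n.+1)%N by exact: leq_maxr.
rewrite !(lin_widen _ le_pn) (bigD1 (Ordinal lt_n)) //= [in RHS](bigD1 (Ordinal lt_n)) //=.
rewrite /upd eqxx mul0rz add0r addrC.
by congr (_ + _); apply: eq_bigr => i; rewrite -val_eqE /= => /negPf->.
Qed.

End LinearForms.

(** A pair [(k, p)] asks that [k] divide the form [p]; with [k = 0] it is the equation [p = 0]. By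
    [pp_exists] such conjunctions are closed under existential quantification. *)
Definition ppform := seq (int * {poly int}).

Definition ppsat (M : zmodType) (e : nat -> M) (s : ppform) : Prop :=
  forall kp, kp \in s -> exists y : M, y *~ kp.1 = lin kp.2 e.

Section PPForms.
Variable M : zmodType.
Implicit Types (e : nat -> M) (s : ppform).

Lemma ppsat_flatten e (ss : seq ppform) :
  ppsat e (flatten ss) <-> forall s, s \in ss -> ppsat e s.
Proof.
split=> [h s ss_s kp skp|h kp /flattenP[s ss_s skp]]; last exact: h skp.
by apply: h; apply/flattenP; exists s.
Qed.

Lemma ppsatB e e' s : ppsat e s -> ppsat e' s -> ppsat (fun i => e i - e' i) s.
Proof.
move=> h h' kp skp; have [[y yE] [y' yE']] := (h kp skp, h' kp skp).
by exists (y - y'); rewrite mulrzBl yE yE' lin_envB.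
Qed.

Lemma ppsat0 s : ppsat (fun=> 0 : M) s.
Proof.
by move=> kp _; exists 0; rewrite mul0rz /lin big1 // => i _; rewrite mul0rz.
Qed.

End PPForms.

(** * Existential quantification over p.p. conditions by Smith normal form *)

Section IntMatrixAction.
Variable M : zmodType.

Definition mxact m n (A : 'M[int]_(m, n)) (w : 'I_n -> M) : 'I_m -> M :=
  fun i => \sum_j w j *~ A i j.

Lemma mxactM m n r (A : 'M[int]_(m, n)) (B : 'M[int]_(n, r)) w :
  mxact (A *m B) w =1 mxact A (mxact B w).
Proof.
move=> i; rewrite /mxact; under eq_bigr => k _ do rewrite mxE.
under [RHS]eq_bigr => j _ do rewrite mulrz_suml.
rewrite exchange_big; apply: eq_bigr => k _ /=; rewrite mulrz_sumr.
by apply: eq_bigr => j _; rewrite mulrC mulrzA.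
Qed.

Lemma mxact1 n (w : 'I_n -> M) : mxact 1%:M w =1 w.
Proof.
move=> i; rewrite /mxact (bigD1 i) //= mxE eqxx mulr1z big1 ?addr0 // => j.
by rewrite mxE eq_sym => /negPf->; rewrite mulr0z.
Qed.

Lemma eq_mxact m n (A : 'M[int]_(m, n)) w w' : w =1 w' -> mxact A w =1 mxact A w'.
Proof. by move=> ww' i; apply: eq_bigr => j _; rewrite ww'. Qed.

End IntMatrixAction.

Section ExistsElimination.
Variables (n : nat) (s : ppform).
Let m := size s.
Let k (i : 'I_m) : int := (nth (0, 0) s i).1.
Let p (i : 'I_m) : {poly int} := (nth (0, 0) s i).2.
Let q (i : 'I_m) : {poly int} := p i - (p i)`_n *: 'X^n.

(** Column 0 belongs to the quantified value [b], column [i + 1] to the witness [y_i] of the [i]-th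
    divisibility; row [i] of the system reads [k_i y_i - (p_i)_n b = q_i(e)]. *)
Let A : 'M[int]_(m, m.+1) := \matrix_(i, j)
  if unlift ord0 j is Some j' then k i *+ (j' == i) else - (p i)`_n.

Let lin_q (M : zmodType) (e : nat -> M) i : lin (q i) e = lin (p i) (upd e n 0).
Proof.
rewrite linB linZ linX [lin _ (upd _ _ _)](_ : _ = lin (p i) (upd e n (e n)) - e n *~ (p i)`_n).
  by congr (_ - _); apply: lin_eq => j _; rewrite /upd; case: eqP => // ->.
by rewrite [in RHS]lin_upd addrK.
Qed.

Let mxactA (M : zmodType) (w : 'I_m.+1 -> M) i :
  mxact A w i = w (lift ord0 i) *~ k i - w ord0 *~ (p i)`_n.
Proof.
rewrite /mxact big_ord_recl mxE unlift_none mulrNz addrC; congr (_ - _).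
rewrite (bigD1 i) //= mxE liftK eqxx mulr1n big1 ?addr0 // => j.
by rewrite mxE liftK => /negPf->; rewrite mulr0n mulr0z.
Qed.

Let pp_exists_solvable (M : zmodType) (e : nat -> M) :
  (exists b, ppsat (upd e n b) s) <->
  exists w, mxact A w =1 fun i => lin (q i) e.
Proof.
split=> [[b bs]|[w wA]].
- have /choice[y yE] : forall i : 'I_m, exists y : M, y *~ k i = lin (p i) (upd e n b).
    by move=> i; apply: bs; rewrite mem_nth.
  exists (fun j => if unlift ord0 j is Some i then y i else b) => i.
  by rewrite mxactA liftK unlift_none yE lin_q lin_upd addrK.
- exists (w ord0) => kp /(nthP (0, 0))[i lt_i <-]; exists (w (lift ord0 (Ordinal lt_i))).
  rewrite [RHS]lin_upd -[lin _ (upd e n 0)](lin_q e (Ordinal lt_i)).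
  by rewrite -(wA (Ordinal lt_i)) mxactA subrK.
Qed.

(** Writing [A = L D R] with [L], [R] invertible over the integers turns the system into
    [D (R w) = L^-1 q]. As [D] is diagonal, solvability is one divisibility condition per row, the
    same in every group. *)
Lemma pp_exists : exists s' : ppform, forall (M : zmodType) (e : nat -> M),
  ppsat e s' <-> exists b, ppsat (upd e n b) s.
Proof.
have [L uL [R uR [d _ ALDR]]] := int_Smith_normal_form A.
set D := \matrix_(_, _) _ in ALDR.
exists [seq (d`_(val i), \sum_j invmx L i j *: q j) | i <- enum 'I_m] => M e.
have mxactD (w : 'I_m.+1 -> M) i : mxact D w i = w (widen_ord (leqnSn m) i) *~ d`_i.
  rewrite /mxact (bigD1 (widen_ord (leqnSn m) i)) //= mxE eqxx mulr1n big1 ?addr0 // => j.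
  by rewrite mxE -val_eqE /= eq_sym => /negPf->; rewrite mulr0n mulr0z.
have linE i : lin (\sum_j invmx L i j *: q j) e = mxact (invmx L) (fun j => lin (q j) e) i.
  by rewrite lin_sum; apply: eq_bigr => j _; rewrite linZ.
rewrite pp_exists_solvable; split=> [h|[w wA] kp /mapP[i _ ->] /=].
- have /choice[y yE] : forall i : 'I_m, exists y : M,
      y *~ d`_i = mxact (invmx L) (fun j => lin (q j) e) i.
    by move=> i; rewrite -linE; apply: (h (_, _)); apply/mapP; exists i; rewrite ?mem_enum.
  (* [D] has one column more than rows; the last coordinate of [R w] is free and is set to 0, the
     case where [insub] fails. *)
  exists (mxact (invmx R) (fun j => if insub (val j) is Some i then y i else 0)) => i.
  rewrite ALDR mxactM (eq_mxact _ (fun j => esym (mxactM _ _ _ j))) mulmxV //.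
  rewrite (eq_mxact _ (mxact1 _)) mxactM.
  rewrite (@eq_mxact _ _ _ _ _ (mxact (invmx L) (fun j => lin (q j) e))).
    by rewrite -mxactM mulmxV // mxact1.
  by move=> j; rewrite mxactD valK yE.
- exists (mxact R w (widen_ord (leqnSn m) i)); rewrite linE -mxactD.
  have <- : mxact A w = fun j => lin (q j) e by apply/funext.
  by rewrite -!mxactM ALDR !mulmxA mulVmx // mul1mx.
Qed.

End ExistsElimination.

(** * Subgroups up to finite index *)

Section FiniteIndex.
Variable M : zmodType.
Implicit Types (B C D H K : M -> Prop) (x y g : M).

Definition subgroup H := H 0 /\ forall x y, H x -> H y -> H (x - y).

Lemma subgroupN H x : subgroup H -> H x -> H (- x).
Proof. by move=> [H0 HB] Hx; rewrite -sub0r; exact: HB. Qed.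

Lemma subgroupD H x y : subgroup H -> H x -> H y -> H (x + y).
Proof. by move=> sH Hx Hy; rewrite -[y]opprK; apply: sH.2 => //; exact: subgroupN. Qed.

Lemma subgroup_sym H x y : subgroup H -> H (x - y) -> H (y - x).
Proof. by move=> sH Hxy; rewrite -opprB; exact: subgroupN. Qed.

Lemma subgroup_trans H y x z : subgroup H -> H (x - y) -> H (y - z) -> H (x - z).
Proof. by move=> sH Hxy Hyz; rewrite -[x](subrK y) -addrA; exact: subgroupD. Qed.

Lemma subgroup_cap (I : eqType) (H : I -> M -> Prop) (s : seq I) :
  (forall i, subgroup (H i)) -> subgroup (fun x => forall i, i \in s -> H i x).
Proof.
move=> sH; split=> [i _|x y Hx Hy i si]; first exact: (sH i).1.
by apply: (sH i).2; [exact: Hx|exact: Hy].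
Qed.

Lemma subgroup_capB B0 B1 : subgroup B0 -> subgroup B1 ->
  subgroup (fun x => B0 x /\ B1 x).
Proof.
move=> s0 s1; split=> [|x y [x0 x1] [y0 y1]]; first by split; [exact: s0.1|exact: s1.1].
by split; [exact: s0.2|exact: s1.2].
Qed.

(** Choosing a point of [B0] in each piece that meets [B0] gives representatives inside [B0], so
    later covers may be indexed arbitrarily and centred outside [B0]. *)
Lemma precsim_cover (I : eqType) (P : I -> M -> Prop) (s : seq I) B0 B1 :
  subgroup B0 ->
  (forall x, B0 x -> exists2 i, i \in s & P i x) ->
  (forall i x y, B0 x -> B0 y -> P i x -> P i y -> B1 (x - y)) ->
  precsim B0 B1.
Proof.
move=> sB0 cov small.
have /choice[g gP] : forall i, exists g, B0 g /\ forall x, B0 x -> P i x -> P i g.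
  move=> i; have [[x [B0x Pix]]|no] := pselect (exists x, B0 x /\ P i x).
    by exists x; split.
  by exists 0; split=> [|x B0x Pix]; [exact: sB0.1 | case: no; exists x].
exists (map g s); split=> [_ /mapP[i _ ->]|x B0x]; first exact: (gP i).1.
have [i si Pix] := cov x B0x; exists (g i); first exact: map_f.
have [B0g gx] := gP i; split; first exact: sB0.2.
by apply: (small i) => //; exact: gx Pix.
Qed.

Lemma precsim_sub B0 B1 : subgroup B0 -> (forall x, B0 x -> B1 x) -> precsim B0 B1.
Proof.
move=> sB0 sub; apply: (precsim_cover (P := fun=> B0) (s := [:: tt])) => //.
  by move=> x B0x; exists tt; rewrite ?mem_seq1.
by move=> _ x y _ _ B0x B0y; apply/sub/sB0.2.
Qed.

Lemma precsim_trans B1 B0 B2 : subgroup B0 -> subgroup B2 ->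
  precsim B0 B1 -> precsim B1 B2 -> precsim B0 B2.
Proof.
move=> s0 s2 [s [_ sP]] [t [_ tP]].
pose P (gh : M * M) x := B2 (x - gh.1 - gh.2).
apply: (precsim_cover (P := P) (s := [seq (g, h) | g <- s, h <- t])) => //.
  move=> x B0x; have [g sg [_ B1xg]] := sP x B0x; have [h th [_ B2xh]] := tP _ B1xg.
  by exists (g, h); first exact: allpairs_f.
move=> gh x y _ _ Px Py.
by apply: (@subgroup_trans _ (gh.1 + gh.2)) => //; [|apply: subgroup_sym => //];
  rewrite opprD addrA.
Qed.

Lemma precsim_capB B0 B1 B2 : subgroup B0 -> subgroup B1 -> subgroup B2 ->
  precsim B0 B1 -> precsim B0 B2 -> precsim B0 (fun x => B1 x /\ B2 x).
Proof.
move=> s0 s1 s2 [s [_ sP]] [t [_ tP]].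
pose P (gh : M * M) x := B1 (x - gh.1) /\ B2 (x - gh.2).
apply: (precsim_cover (P := P) (s := [seq (g, h) | g <- s, h <- t])) => //.
  move=> x B0x; have [g sg [_ B1xg]] := sP x B0x; have [h th [_ B2xh]] := tP x B0x.
  by exists (g, h); first exact: allpairs_f.
move=> gh x y _ _ [Px1 Px2] [Py1 Py2].
split; first by apply: (@subgroup_trans _ gh.1) => //; exact: subgroup_sym.
by apply: (@subgroup_trans _ gh.2) => //; exact: subgroup_sym.
Qed.

Lemma precsim_cap (I : eqType) (H : I -> M -> Prop) (s : seq I) B0 :
  subgroup B0 -> (forall i, subgroup (H i)) ->
  (forall i, i \in s -> precsim B0 (H i)) ->
  precsim B0 (fun x => forall i, i \in s -> H i x).
Proof.
move=> s0 sH; elim: s => [_|i s IH h]; first exact: precsim_sub.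
have -> : (fun x => forall j, j \in i :: s -> H j x) =
    (fun x => H i x /\ forall j, j \in s -> H j x).
  apply/funext => x; apply/propext; split=> [Hx|[Hix Hx] j].
    by split=> [|j sj]; apply: Hx; rewrite inE ?eqxx ?sj ?orbT.
  by rewrite inE => /predU1P[->//|/Hx].
apply: precsim_capB => //; first exact: subgroup_cap.
  by apply: h; rewrite inE eqxx.
by apply: IH => j sj; apply: h; rewrite inE sj orbT.
Qed.

(** Greedy choice: no finite list of [B1]-cosets covers [B0], so a further element of [B0] can
    always be found outside the cosets of those already chosen. *)
Lemma not_precsim_seq B0 B1 : subgroup B0 -> subgroup B1 -> ~ precsim B0 B1 ->
  exists b : nat -> M, (forall j, B0 (b j)) /\ forall j k, j <> k -> ~ B1 (b j - b k).
Proof.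
move=> s0 s1 no.
have /choice[f fP] : forall s : seq M, exists x, B0 x /\ forall g, g \in s -> ~ B1 (x - g).
  move=> s; apply: contrapT => h; apply: no.
  apply: (precsim_cover (P := fun g x => B1 (x - g)) (s := s)) => //.
    move=> x B0x; apply: contrapT => h'; apply: h; exists x; split=> // g sg B1g.
    by apply: h'; exists g.
  by move=> g x y _ _ xg yg; apply: (@subgroup_trans _ g) => //; exact: subgroup_sym.
pose l := fix l n := if n is n'.+1 then f (l n') :: l n' else [::].
have lP j k : (j < k)%N -> f (l j) \in l k.
  elim: k => // k IH; rewrite ltnS leq_eqVlt => /predU1P[->|/IH h].
    by rewrite inE eqxx.
  by rewrite inE h orbT.
exists (fun j => f (l j)); split=> [j|j k]; first exact: (fP _).1.
have half i i' : (i < i')%N -> ~ B1 (f (l i') - f (l i)).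
  by move=> /lP; exact: (fP _).2.
move=> /eqP; rewrite neq_ltn => /orP[lt_jk /(subgroup_sym s1)|]; exact: half.
Qed.

(* B. H. Neumann's lemma, by induction on the number of subgroups: a coset of
   [H j] missed by the chosen cosets of [H j] is covered by the other subgroups,
   hence so are its translates, hence so is everything. *)
Lemma neumann_cover (I : eqType) (H : I -> M -> Prop) (B : M -> Prop)
    (s : seq I) (S : I -> seq M) :
  (forall i, subgroup (H i)) -> subgroup B ->
  (forall x, B x -> exists2 i, i \in s & exists2 g, g \in S i & H i (x - g)) ->
  exists2 i, i \in s & precsim B (H i).
Proof.
move=> sH sB; elim: s S => [S cov|j s IH S cov]; first by have [] := cov 0 sB.1.
have [fin|inf] := pselect (precsim B (H j)); first by exists j; rewrite ?inE ?eqxx.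
have [h [Bh hS]] : exists h, B h /\ forall g, g \in S j -> ~ H j (h - g).
  apply: contrapT => no; apply: inf.
  apply: (precsim_cover (P := fun g x => H j (x - g)) (s := S j)) => //.
    move=> x Bx; apply: contrapT => h'; apply: no; exists x; split=> // g sg Hg.
    by apply: h'; exists g.
  by move=> g x y _ _ xg yg; apply: (@subgroup_trans _ g) => //; exact: subgroup_sym.
have /choice[r rP] : forall g, exists r, forall x, B x -> H j (x - g) -> B r /\ H j (r - g).
  move=> g; have [[x [Bx Hx]]|no] := pselect (exists x, B x /\ H j (x - g)).
    by exists x.
  by exists 0 => x Bx Hx; case: no; exists x.
have [|i si fin] := IH (fun i => S i ++ [seq g' + r g - h | g <- S j, g' <- S i]).
  move=> x Bx; have [i] := cov x Bx; rewrite inE => /predU1P[->|si] [g Sg Hg]; last first.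
    by exists i => //; exists g; rewrite // mem_cat Sg.
  have [Br Hr] := rP g x Bx Hg.
  have Hxr : H j (x - r g) by apply: (@subgroup_trans _ g) => //; exact: subgroup_sym.
  have [|i'] := cov (x - r g + h); first by apply: subgroupD => //; exact: sB.2.
  rewrite inE => /predU1P[->|si'] [g' Sg' Hg'].
    case: (hS g' Sg'); apply: (@subgroup_trans _ (x - r g + h)) => //.
    by apply: subgroup_sym => //; rewrite addrK.
  exists i' => //; exists (g' + r g - h).
    by rewrite mem_cat; apply/orP; right; apply: allpairs_f.
  move: Hg'; congr (H i' _); rewrite opprB opprD -!addrA; congr (x + _).
  by rewrite addrC addrA.
by exists i; rewrite // inE si orbT.
Qed.

(** The empty set qualifies, so fibers of p.p. formulas without solutions are included. *)
Definition coset_like H D := forall x, D x -> forall y, D y <-> H (x - y).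

(** Let [K] be the intersection of [B] with those [H i] for which [precsim B (H i)]. If their pieces
    missed [x0], they would miss all of [x0 + K], which the other pieces would then cover;
    [neumann_cover] gives [precsim K (H i)] for one of those, hence [precsim B (H i)], a
    contradiction. *)
Lemma neumann (I : eqType) (H D : I -> M -> Prop) (B C : M -> Prop) (s : seq I) :
  (forall i, subgroup (H i)) -> subgroup B ->
  (forall i, coset_like (H i) (D i)) -> coset_like B C ->
  (forall x, C x -> exists2 i, i \in s & D i x) ->
  forall x, C x -> exists2 i, i \in s & precsim B (H i) /\ D i x.
Proof.
move=> sH sB cD cC cov x0 Cx0; apply: contrapT => no.
pose fin i := `[< precsim B (H i) >].
pose K x := B x /\ forall i, i \in [seq i <- s | fin i] -> H i x.
have sK : subgroup K by apply: subgroup_capB => //; exact: subgroup_cap.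
have BK : precsim B K.
  apply: precsim_capB => //; [exact: subgroup_cap|exact: precsim_sub|].
  by apply: precsim_cap => // i; rewrite mem_filter => /andP[/asboolP].
have /choice[d dP] : forall i, exists d, forall x, D i x -> D i d.
  move=> i; have [[x Dx]|nD] := pselect (exists x, D i x); first by exists x.
  by exists 0 => x Dx; case: nD; exists x.
have [||i] := @neumann_cover _ H K [seq i <- s | ~~ fin i] (fun i => [:: d i - x0]) sH.
- by [].
- move=> z [Bz Hz]; have [|i si Dz] := cov (x0 + z).
    by apply/(cC _ Cx0); rewrite opprD addNKr; exact: subgroupN.
  exists i.
    rewrite mem_filter si andbT; apply/negP => fi; apply: no; exists i => //.
    split; first exact/asboolP.
    apply/(cD _ _ Dz); rewrite addrAC subrr add0r.
    by apply: Hz; rewrite mem_filter fi.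
  exists (d i - x0); rewrite ?mem_seq1 //.
  by rewrite opprB addrA [z + x0]addrC; apply/(cD _ _ Dz); exact: dP Dz.
rewrite mem_filter => /andP[/negP nfi si Ki]; apply: nfi.
exact/asboolP/(precsim_trans sB _ BK Ki).
Qed.

Lemma coset_reps B K : subgroup K -> precsim B K -> exists hs : seq M,
  [/\ uniq hs, (forall h, h \in hs -> B h),
      (forall x, B x -> exists2 h, h \in hs & K (x - h)) &
      forall h h', h \in hs -> h' \in hs -> K (h - h') -> h = h'].
Proof.
move=> sK [s [sB sP]].
suff [hs [u sub cov inj]] : exists hs : seq M, [/\ uniq hs, {subset hs <= s},
    (forall g, g \in s -> exists2 h, h \in hs & K (g - h)) &
    forall h h', h \in hs -> h' \in hs -> K (h - h') -> h = h'].
  exists hs; split=> // [h /sub/sB//|x Bx].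
  have [g sg [_ Kxg]] := sP x Bx; have [h hsh Kgh] := cov g sg.
  by exists h => //; exact: subgroup_trans Kxg Kgh.
elim: s {sB sP} => [|g s [hs [u sub cov inj]]]; first by exists [::].
have [[h hsh Kgh]|no] := pselect (exists2 h, h \in hs & K (g - h)).
  exists hs; split=> // [x /sub sx|x]; first by rewrite inE sx orbT.
  by rewrite inE => /predU1P[->|/cov//]; exists h.
exists (g :: hs); split=> /=.
- rewrite u andbT; apply/negP => hsg; apply: no; exists g => //.
  by rewrite subrr; exact: sK.1.
- by move=> x; rewrite !inE => /predU1P[->|/sub->]; rewrite ?eqxx ?orbT.
- move=> x; rewrite inE => /predU1P[->|/cov[h hsh Kxh]].
    by exists g; rewrite ?inE ?eqxx // subrr; exact: sK.1.
  by exists h; rewrite // inE hsh orbT.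
- move=> h h'; rewrite !inE => /predU1P[->|hsh] /predU1P[->|hsh'] Khh' //.
  + by case: no; exists h'.
  + by case: no; exists h => //; exact: subgroup_sym.
  + exact: inj.
Qed.

(** Translation by an element of [B] permutes the [K]-cosets of [B], and [S] is constant on each of
    them. *)
Lemma count_reps_translate B K (hs : seq M) (S : pred M) g :
  subgroup B -> subgroup K ->
  uniq hs -> (forall h, h \in hs -> B h) ->
  (forall x, B x -> exists2 h, h \in hs & K (x - h)) ->
  (forall h h', h \in hs -> h' \in hs -> K (h - h') -> h = h') ->
  (forall x y, K (x - y) -> S x = S y) -> B g ->
  count (fun h => S (h - g)) hs = count S hs.
Proof.
move=> sB sK u hsB cov inj SK Bg.
have /choice[f fP] : forall h, exists h', h \in hs -> h' \in hs /\ K (h - g - h').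
  move=> h; have [hsh|] := boolP (h \in hs); last by exists 0.
  by have [h' ? ?] := cov (h - g) (sB.2 _ _ (hsB _ hsh) Bg); exists h'.
have f_inj : {in hs &, injective f}.
  move=> h h' hsh hsh' ff'; apply: inj => //.
  have [_ Kh] := fP _ hsh; have [_ Kh'] := fP _ hsh'; rewrite -ff' in Kh'.
  rewrite -[h](subrK g) -addrA -[g - h']opprB.
  by apply: (subgroup_trans sK Kh); exact: subgroup_sym.
have uf : uniq (map f hs) by rewrite map_inj_in_uniq.
have sub : {subset map f hs <= hs} by move=> _ /mapP[h /fP[]? _ ->].
have [|_ eqf] := uniq_min_size uf sub; first by rewrite size_map.
rewrite -[RHS](permP (uniq_perm uf u eqf)) count_map; apply: eq_in_count => h /fP[_ Kh] /=.
exact: (SK _ _ Kh).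
Qed.

End FiniteIndex.

(** * Baur-Monk elimination *)

Section QuantifierElimination.
Variable M : zmodType.
Implicit Types (e : nat -> M) (p q : ppform) (ps : seq ppform).

Definition fiber e n p : M -> Prop := fun x => ppsat (upd e n x) p.

Definition ppgroup n p : M -> Prop := fiber (fun=> 0) n p.

Lemma updB e e' n x y :
  (fun i => upd e n x i - upd e' n y i) = upd (fun i => e i - e' i) n (x - y).
Proof. by apply/funext => i; rewrite /upd; case: eqP. Qed.

Lemma ppgroup_subgroup n p : subgroup (ppgroup n p).
Proof.
split=> [|x y px py].
  rewrite /ppgroup /fiber (_ : upd _ n 0 = fun=> 0); first exact: ppsat0.
  by apply/funext => i; rewrite /upd; case: eqP.
have := ppsatB px py; rewrite updB /ppgroup /fiber; congr ppsat.
by congr upd; apply/funext => i; rewrite subr0.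
Qed.

Lemma fiber_coset e n p : coset_like (ppgroup n p) (fiber e n p).
Proof.
move=> x px y; split=> [py|pxy].
  have := ppsatB px py; rewrite updB; congr ppsat.
  by congr upd; apply/funext => i; rewrite subrr.
have := ppsatB px pxy; rewrite updB subKr; congr ppsat; congr upd.
by apply/funext => i; rewrite subr0.
Qed.

Fixpoint subseqs (T : Type) (s : seq T) : seq (seq T) :=
  if s is x :: s' then subseqs s' ++ map (cons x) (subseqs s') else [:: [::]].

Lemma filter_subseqs (T : eqType) (a : pred T) (s : seq T) : [seq x <- s | a x] \in subseqs s.
Proof.
elim: s => [|x s IH] //=; rewrite mem_cat; case: ifP => _; last by rewrite IH.
by rewrite map_f ?orbT.
Qed.

Definition same_pp ps e e' := forall p, p \in ps -> ppsat e p <-> ppsat e' p.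

Lemma same_pp_sym ps e e' : same_pp ps e e' -> same_pp ps e' e.
Proof. by move=> h p /h[]. Qed.

Section Extension.
Variables (n : nat) (ps : seq ppform).

(* The number of [K]-cosets of a coset of [B] that meet all of [t] and none of
   [L] follows by inclusion-exclusion from which intersections are nonempty. *)
Lemma count_fibers (B K : M -> Prop) (hs : seq M) e e' a a' (L t : seq ppform) :
  subgroup B -> subgroup K ->
  uniq hs -> (forall h, h \in hs -> B h) ->
  (forall x, B x -> exists2 h, h \in hs & K (x - h)) ->
  (forall h h', h \in hs -> h' \in hs -> K (h - h') -> h = h') ->
  (forall q, q \in L ++ t -> forall x, K x -> ppgroup n q x) ->
  (forall x, (forall q, q \in t -> fiber e n q x) -> B (x - a)) ->
  (forall x, (forall q, q \in t -> fiber e' n q x) -> B (x - a')) ->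
  (forall t' : seq ppform, {subset t' <= L ++ t} ->
    (exists x, forall q, q \in t' -> fiber e n q x) <->
    (exists x, forall q, q \in t' -> fiber e' n q x)) ->
  let cnt e a L t := count (fun h => `[< (forall q, q \in t -> fiber e n q (a + h)) /\
    (forall q, q \in L -> ~ fiber e n q (a + h)) >]) hs in
  cnt e a L t = cnt e' a' L t.
Proof.
move=> sB sK u hsB cov inj; elim: L t => [|p L IH] t KL tB tB' key cnt.
(* With no excluded formulas, a common point of the fibers lets a translation inside [B] replace
   them by the subgroups [ppgroup n q], whose count is independent of the parameters. *)
- have cnt_shift e0 a0 : (forall x, (forall q, q \in t -> fiber e0 n q x) -> B (x - a0)) ->
      (exists x, forall q, q \in t -> fiber e0 n q x) ->
      cnt e0 a0 [::] t = count (fun h => `[< forall q, q \in t -> ppgroup n q h >]) hs.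
    move=> tB0 [x0 x0P].
    rewrite -(count_reps_translate (S := fun h => `[< forall q, q \in t -> ppgroup n q h >])
      sB sK u hsB cov inj _ (tB0 _ x0P)).
      apply: eq_count => h; apply/asboolP/asboolP => [[h1 _] q tq|h1].
        have /(fiber_coset (h1 q tq)) := x0P q tq.
        by congr (ppgroup n q _); rewrite opprB addrCA addrA.
      split=> // q tq; apply/(fiber_coset (x0P q tq)).
      apply: (subgroup_sym (ppgroup_subgroup n q)).
      by move: (h1 q tq); congr (ppgroup n q _); rewrite opprB addrCA addrA.
    move=> x y Kxy; apply: asbool_equiv_eq; split=> h1 q tq.
      rewrite -[y](subKr x); apply: (ppgroup_subgroup n q).2; first exact: h1.
      by apply: KL.
    rewrite -[x](subrK y); apply: (subgroupD (ppgroup_subgroup n q)); last exact: h1.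
    by apply: KL.
  have key_t := key t (fun q tq => tq).
  have cnt0 e0 a0 : ~ (exists x, forall q, q \in t -> fiber e0 n q x) -> cnt e0 a0 [::] t = 0%N.
    move=> no; apply/eqP; rewrite eqn0Ngt -has_count; apply/hasPn => h _.
    by apply/asboolPn => -[h1 _]; apply: no; exists (a0 + h).
  have [ex|nex] := pselect (exists x, forall q, q \in t -> fiber e n q x).
    by rewrite !cnt_shift //; apply/key_t.
  by rewrite !cnt0 // => /key_t.
(* The count for [(p :: L, t)] is the difference of those for [(L, t)] and [(L, p :: t)], to which
   induction applies. *)
- have split_cnt e0 a0 : cnt e0 a0 L t = (cnt e0 a0 (p :: L) t + cnt e0 a0 L (p :: t))%N.
    rewrite /cnt addnC -count_predUI [X in (_ + X)%N](_ : _ = 0%N) ?addn0.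
      apply: eq_count => h /=; apply/asboolP/orP => [[h1 h2]|[/asboolP|/asboolP][h1 h2]].
      + have [ph|nph] := pselect (fiber e0 n p (a0 + h)); [left|right];
          apply/asboolP; split=> //.
          by move=> q; rewrite inE => /predU1P[->|/h1].
        by move=> q; rewrite inE => /predU1P[->|/h2].
      + by split=> // q tq; apply: h1; rewrite inE tq orbT.
      + by split=> // q Lq; apply: h2; rewrite inE Lq orbT.
    apply/eqP; rewrite eqn0Ngt -has_count; apply/hasPn => h _ /=.
    apply/negP => /andP[/asboolP[h1 _] /asboolP[_ h2]].
    by apply: (h2 p); [rewrite inE eqxx|apply: h1; rewrite inE eqxx].
  have e1 : cnt e a L t = cnt e' a' L t.
    apply: IH => // [q Lq|t' sub]; first by apply: KL; rewrite inE Lq orbT.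
    by apply: key => q /sub Lq; rewrite inE Lq orbT.
  have pt q : (q \in L ++ p :: t) = (q \in (p :: L) ++ t).
    by rewrite !(mem_cat, inE) orbCA orbA.
  have e2 : cnt e a L (p :: t) = cnt e' a' L (p :: t).
    apply: IH => // [q|x h|x h|t' sub].
    + by rewrite pt; exact: KL.
    + by apply: tB => q tq; apply: h; rewrite inE tq orbT.
    + by apply: tB' => q tq; apply: h; rewrite inE tq orbT.
    + by apply: key => q /sub; rewrite pt.
  by move: e1; rewrite !split_cnt e2 => /addIn.
Qed.

(** [ps'] consists of the projections of all subconjunctions of [ps]. If no [b'] worked, the coset
    cut out over [e'] by the formulas true at [b] would be covered by those false at [b], and by
    [neumann] already by those of finite index. The number of uncovered [K]-cosets would then be 0
    over [e'] but positive over [e], against [count_fibers]. *)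
Lemma same_pp_extend : exists ps', forall e e', same_pp ps' e e' ->
  forall b, exists b', same_pp ps (upd e n b) (upd e' n b').
Proof.
have /choice[ex exP] := @pp_exists n.
exists [seq ex (flatten t) | t <- subseqs ps] => e e' ee' b.
have key (t : seq ppform) : {subset t <= ps} ->
    (exists x, forall q, q \in t -> fiber e n q x) <->
    (exists x, forall q, q \in t -> fiber e' n q x).
  (* [t] may repeat or permute formulas; [t'] has the same members in the order of [ps], hence
     belongs to [subseqs ps]. *)
  move=> sub; pose t' := [seq q <- ps | q \in t].
  have tt' q : (q \in t') = (q \in t)
    by rewrite mem_filter; case: (boolP (q \in t)) => // /sub->.
  have exE e0 : (exists x, forall q, q \in t -> fiber e0 n q x) <-> ppsat e0 (ex (flatten t')).
    rewrite exP; split=> -[x xP]; exists x.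
      by apply/ppsat_flatten => q; rewrite tt' => /xP.
    by move=> q tq; move/ppsat_flatten: xP; apply; rewrite tt'.
  rewrite !exE; apply: ee'; apply: map_f; exact: filter_subseqs.
pose pos := [seq q <- ps | `[< fiber e n q b >]].
pose neg := [seq q <- ps | ~~ `[< fiber e n q b >]].
have pos_fiber q : q \in pos -> fiber e n q b by rewrite mem_filter => /andP[/asboolP].
have neg_fiber q : q \in neg -> ~ fiber e n q b by rewrite mem_filter => /andP[/asboolPn].
have [a aP] : exists a, forall q, q \in pos -> fiber e' n q a.
  apply/key; first by move=> q; rewrite mem_filter => /andP[].
  by exists b.
apply: contrapT => no.
pose C x := forall q, q \in pos -> fiber e' n q x.
have cov x : C x -> exists2 q, q \in neg & fiber e' n q x.
  move=> Cx; apply: contrapT => nq; apply: no; exists x => q psq; split=> [eq|eq'].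
    by apply: Cx; rewrite mem_filter psq andbT; apply/asboolP.
  apply: contrapT => neq; apply: nq; exists q => //; rewrite mem_filter psq andbT.
  exact/asboolPn.
pose B x := forall q, q \in pos -> ppgroup n q x.
have sB : subgroup B by apply: subgroup_cap => q; exact: ppgroup_subgroup.
have cB e0 : coset_like B (fun x => forall q, q \in pos -> fiber e0 n q x).
  by move=> x xP y; split=> yP q pq; apply/(fiber_coset (xP q pq)); exact: yP.
pose fin q := `[< precsim B (ppgroup n q) >].
pose neg0 := [seq q <- neg | fin q].
have cov0 x : C x -> exists2 q, q \in neg0 & fiber e' n q x.
  move=> Cx.
  have := neumann (ppgroup_subgroup n) sB (fun q => @fiber_coset e' n q) (cB e') cov Cx.
  by move=> [q nq [fq qx]]; exists q => //; rewrite mem_filter nq andbT; apply/asboolP.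
pose K x := B x /\ forall q, q \in neg0 -> ppgroup n q x.
have sK : subgroup K.
  by apply: subgroup_capB => //; apply: subgroup_cap => q; exact: ppgroup_subgroup.
have BK : precsim B K.
  have sG q : subgroup (@ppgroup n q) by exact: ppgroup_subgroup.
  apply: precsim_capB => //; [exact: subgroup_cap|exact: precsim_sub|].
  by apply: precsim_cap => // q; rewrite mem_filter => /andP[/asboolP].
have [hs [u hsB hcov inj]] := coset_reps sK BK.
have neg0P q : q \in neg0 -> q \in neg by rewrite mem_filter => /andP[].
pose c := count (fun h => `[< (forall q, q \in pos -> fiber e' n q (a + h)) /\
    (forall q, q \in neg0 -> ~ fiber e' n q (a + h)) >]) hs.
have c0 : c = 0%N.
  apply/eqP; rewrite eqn0Ngt -has_count; apply/hasPn => h _.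
  by apply/asboolPn => -[/cov0[q nq qah] /(_ q nq)].
suff : (0 < c)%N by rewrite c0.
rewrite /c -(@count_fibers B K hs e e' b a neg0 pos) //.
(* [h] represents the coset [K] itself, so [b + h] agrees with [b] on [pos] and [neg0] and is
   counted over [e]. *)
- rewrite -has_count; have [h hsh [Bh Kh]] := hcov 0 sB.1; rewrite sub0r in Bh Kh.
  have fibh q : ppgroup n q (- h) -> fiber e n q b <-> fiber e n q (b + h).
    move=> qh; split=> [qb|qb]; apply/(fiber_coset qb).
      by rewrite opprD addNKr.
    by rewrite [b + h]addrC addrK -[h]opprK; exact: (subgroupN (ppgroup_subgroup n q)).
  apply/hasP; exists h => //; apply/asboolP; split=> q nq.
    by apply/fibh; [exact: Bh|exact: pos_fiber].
  by move=> /(fibh _ (Kh q nq)); apply/neg_fiber/neg0P.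
- by move=> q; rewrite mem_cat => /orP[nq x [_ /(_ q nq)]|pq x [/(_ q pq)]].
- by move=> x xP q pq; apply/(fiber_coset (xP q pq)); exact: pos_fiber.
- by move=> x xP q pq; apply/(fiber_coset (xP q pq)); exact: aP.
- move=> t sub; apply: key => q /sub; rewrite mem_cat => /orP[/neg0P|];
    by rewrite mem_filter => /andP[].
Qed.

End Extension.

Lemma teval_lin t : exists p : {poly int}, forall e, teval e t = lin p e.
Proof.
elim: t => [n|t [p pE] t' [p' pE']]; first by exists 'X^n => e; rewrite linX.
by exists (p + p') => e /=; rewrite linD pE pE'.
Qed.

(** This is the semantic form of Baur-Monk elimination. Boolean connectives reuse or join the lists;
    for a quantifier, [same_pp_extend] supplies a matching witness. *)
Lemma sat_same_pp f : exists ps, forall e e', same_pp ps e e' -> sat e f -> sat e' f.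
Proof.
elim: f => [t t'|f [ps psP]|f [ps psP] g [ps' psP']|n f [ps psP]].
- have [[p pE] [p' pE']] := (teval_lin t, teval_lin t').
  exists [:: [:: (0, p - p')]] => e e' ee' /=.
  have ppE e0 : teval e0 t = teval e0 t' <-> ppsat e0 [:: (0, p - p')].
    split=> [tt' kp|h].
      by rewrite inE => /eqP->; exists 0; rewrite linB -pE -pE' tt' subrr.
    by have [y] := h _ (mem_head _ _); rewrite linB mulr0z pE pE' => /esym/subr0_eq.
  by move=> /ppE h; apply/ppE/(ee' _ (mem_head _ _)).
- exists ps => e e' ee' /= nf h; apply: nf; apply: psP h; exact: same_pp_sym.
- exists (ps ++ ps') => e e' ee' /= [ef eg].
  split; [apply: psP ef|apply: psP' eg] => p pp; apply: ee';
    by rewrite mem_cat pp ?orbT.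
- have [ps' ext] := same_pp_extend n ps; exists ps' => e e' /ext h /= [b ef].
  by have [b' bb'] := h b; exists b'; exact: psP ef.
Qed.

End QuantifierElimination.

(** * First-order transfer *)

Definition posn (c : int) : nat := if c is Posz n then n else 0%N.
Definition negn (c : int) : nat := if c is Negz n then n.+1 else 0%N.

Lemma mulrz_posn_negn (M : zmodType) (x : M) c : x *~ c = x *+ posn c - x *+ negn c.
Proof. by case: c => n /=; rewrite ?mulr0n ?subr0 // sub0r NegzE mulrNz. Qed.

(* The language has no zero and no subtraction: [lin p e = 0] is written with a
   superfluous summand [e 0] on both sides and the coefficients split by sign. *)
Definition natlin_term (c : nat -> nat) (n : nat) : term :=
  foldr (fun i t => iter (c i) (TAdd (TVar i)) t) (TVar 0) (iota 0 n).

Definition lin_eq0 (p : {poly int}) : formula :=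
  FEq (natlin_term (fun i => posn p`_i) (size p))
      (natlin_term (fun i => negn p`_i) (size p)).

Definition fconj (fs : seq formula) : formula :=
  foldr FAnd (FEq (TVar 0) (TVar 0)) fs.

(** The bound variable has index [size kp.2], beyond every variable of the form, so none of these is
    captured. *)
Definition fdivides (kp : int * {poly int}) : formula :=
  FEx (size kp.2) (lin_eq0 (kp.2 - kp.1 *: 'X^(size kp.2))).

Definition fpp (s : ppform) : formula := fconj (map fdivides s).

Section FormulaSemantics.
Variable M : zmodType.
Implicit Type e : nat -> M.

Lemma teval_natlin e c n : teval e (natlin_term c n) = e 0%N + \sum_(i < n) e i *+ c i.
Proof.
rewrite -(big_mkord xpredT (fun i => e i *+ c i)) /index_iota subn0 /natlin_term.
elim: (iota 0 n) => [|i l IH] /=; first by rewrite big_nil addr0.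
rewrite big_cons; elim: (c i) => [|m IHm] /=; first by rewrite IH mulr0n add0r.
by rewrite IHm mulrS -[in RHS]addrA [LHS]addrCA.
Qed.

Lemma sat_lin_eq0 e p : sat e (lin_eq0 p) <-> lin p e = 0.
Proof.
rewrite /= !teval_natlin.
have -> : lin p e = \sum_(i < size p) e i *+ posn p`_i - \sum_(i < size p) e i *+ negn p`_i.
  by rewrite -sumrB; apply: eq_bigr => i _; rewrite mulrz_posn_negn.
by split=> [/addrI->|/subr0_eq->]; rewrite ?subrr.
Qed.

Lemma sat_fconj (I : eqType) e (F : I -> formula) s :
  sat e (fconj (map F s)) <-> forall i, i \in s -> sat e (F i).
Proof.
elim: s => [|i s IH] /=; first by split.
rewrite IH; split=> [[Fi Fs] j|h]; first by rewrite inE => /predU1P[->|/Fs].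
by split=> [|j sj]; apply: h; rewrite inE ?eqxx ?sj ?orbT.
Qed.

Lemma sat_fpp e s : sat e (fpp s) <-> ppsat e s.
Proof.
rewrite sat_fconj; split=> h [k p] /h {h}.
  move=> [y /sat_lin_eq0]; rewrite linB linZ linX /upd eqxx => /subr0_eq yE.
  by exists y; rewrite -yE; apply: lin_eq => i lt_i; rewrite ltn_eqF.
move=> [y /= yE]; exists y; apply/sat_lin_eq0; rewrite linB linZ linX /upd eqxx yE.
by rewrite (lin_eq (e' := e)) ?subrr // => i lt_i; rewrite ltn_eqF.
Qed.

End FormulaSemantics.

(** The one-variable condition is imposed on a linear form: ['X^0] gives the subgroup, ['X^0 - 'X^1]
    its coset through variable 1. *)
Definition ppin (s : seq (int * int)) (l : {poly int}) : ppform :=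
  [seq (km.1, km.2 *: l) | km <- s].

(** When all variables except variable 0 vanish, a form retains only its constant coefficient; this
    puts [ppgroup 0 p] in the shape of [pp_of]. *)
Definition ppgroup_form (p : ppform) : seq (int * int) :=
  [seq (kp.1, (kp.2 : {poly int})`_0) | kp <- p].

Section OneVariable.
Variable M : zmodType.
Implicit Type e : nat -> M.

Lemma ppsat_ppin e s l : ppsat e (ppin s l) <-> pp_of s (lin l e).
Proof.
split=> h => [km skm|_ /mapP[km skm ->]] /=; last by rewrite linZ; exact: h.
by have := h _ (map_f _ skm); rewrite /= linZ.
Qed.

Lemma pp_of_ppgroup_form p (x : M) : pp_of (ppgroup_form p) x <-> ppgroup 0 p x.
Proof.
have linE (q : {poly int}) : lin q (upd (fun=> 0) 0 x) = x *~ q`_0.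
  rewrite lin_upd [lin _ _]big1 ?add0r // => i _.
  by rewrite /upd; case: eqP; rewrite mul0rz.
split=> h => [kp skp|_ /mapP[kp skp ->]] /=; last by rewrite -linE; exact: h.
by rewrite linE; have := h _ (map_f _ skp).
Qed.

Lemma pp_of_subgroup s : subgroup (pp_of (A := M) s).
Proof.
split=> [km _|x y sx sy km skm]; first by exists 0; rewrite !mul0rz.
have [[z zE] [t tE]] := (sx km skm, sy km skm).
by exists (z - t); rewrite !mulrzBl zE tE.
Qed.

Lemma pp_of_cat s t (x : M) : pp_of (s ++ t) x <-> pp_of s x /\ pp_of t x.
Proof.
split=> [h|[h h'] km]; last by rewrite mem_cat => /orP[/h|/h'].
by split=> km skm; apply: h; rewrite mem_cat skm ?orbT.
Qed.

End OneVariable.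

Fixpoint fexists (n : nat) (f : formula) : formula :=
  if n is n'.+1 then fexists n' (FEx n' f) else f.

Lemma sat_fexists (M : zmodType) n f (e : nat -> M) :
  sat e (fexists n f) <-> exists e', (forall i, (n <= i)%N -> e' i = e i) /\ sat e' f.
Proof.
elim: n f => [|n IH] f /=.
  split=> [ef|[e' [e'e ef]]]; first by exists e.
  by have <- : e' = e by apply/funext => i; exact: e'e.
rewrite IH; split=> [[e' [e'e [b ef]]]|[e' [e'e ef]]].
  exists (upd e' n b); split=> // i lt_ni.
  by rewrite /upd gtn_eqF // e'e // ltnW.
exists (upd e' n (e n)); split=> [i le_ni|].
  by rewrite /upd; case: eqP => [->//|/eqP ne]; rewrite e'e // ltn_neqAle eq_sym ne.
exists (e' n); congr sat: ef; apply/funext => i; rewrite /upd.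
by case: eqP => // ->.
Qed.

Section Transfer.
Variables (A M : zmodType).
Hypothesis AM : elem_equiv A M.
Implicit Types s t : seq (int * int).

Lemma pp_of_sub_transfer s t :
  (forall x : A, pp_of s x -> pp_of t x) -> forall x : M, pp_of s x -> pp_of t x.
Proof.
move=> sub.
pose f := FNeg (FAnd (fpp (ppin s 'X^0)) (FNeg (fpp (ppin t 'X^0)))).
have /AM Mf : valid A f.
  by move=> e /= [/sat_fpp/ppsat_ppin/sub ts]; apply; apply/sat_fpp/ppsat_ppin.
move=> x sx; apply: contrapT => ntx; apply: (Mf (fun=> x)).
split; first by apply/sat_fpp/ppsat_ppin; rewrite linX.
by move=> /sat_fpp/ppsat_ppin; rewrite linX.
Qed.

(** For fixed [k], covering the subgroup by [k] cosets is a first-order sentence: variables below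
    [k] hold the representatives, variable [k] the element to be covered. *)
Lemma precsim_transfer s t :
  precsim (pp_of (A := A) s) (pp_of t) -> precsim (pp_of (A := M) s) (pp_of t).
Proof.
move=> [g [_ gP]]; set k := size g.
pose f := FNeg (FEx k (FAnd (fpp (ppin s 'X^k))
  (fconj [seq FNeg (fpp (ppin t ('X^k - 'X^i))) | i <- iota 0 k]))).
have satf (N : zmodType) (e : nat -> N) : sat e f <->
    forall x, pp_of s x -> exists2 i, (i < k)%N & pp_of t (x - e i).
  have linE x i : (i < k)%N -> lin ('X^k - 'X^i) (upd e k x) = x - e i.
    by move=> lt_ik; rewrite linB !linX /upd eqxx ltn_eqF.
  split=> [nf x sx|h /= [x [/sat_fpp/ppsat_ppin]]].
    apply: contrapT => no; apply: nf; exists x; split.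
      by apply/sat_fpp/ppsat_ppin; rewrite linX /upd eqxx.
    apply/sat_fconj => i; rewrite mem_iota => /= lt_ik /sat_fpp/ppsat_ppin.
    by rewrite linE // => ti; apply: no; exists i.
  rewrite linX /upd eqxx => /h[i lt_ik ti] /sat_fconj/(_ i).
  by rewrite mem_iota => /(_ lt_ik) /=; apply; apply/sat_fpp/ppsat_ppin; rewrite linE.
have /AM/(_ (fun=> 0)) : valid A (fexists k f).
  move=> e; apply/sat_fexists; exists (fun i => if (i < k)%N then nth 0 g i else e i).
  split=> [i|]; first by rewrite ltnNge => ->.
  apply/satf => x /gP[h gh [_ th]]; exists (index h g); first by rewrite index_mem.
  by rewrite index_mem gh nth_index.
move=> /sat_fexists[e [_ /satf ef]].
apply: (precsim_cover (P := fun i x => pp_of t (x - e i)) (s := iota 0 k)).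
- exact: pp_of_subgroup.
- by move=> x /ef[i lt_ik ti]; exists i; rewrite // mem_iota.
- move=> i x y _ _ tx ty; have st := @pp_of_subgroup M t.
  exact: (@subgroup_trans _ _ (e i) _ _ st tx (subgroup_sym st ty)).
Qed.

End Transfer.

(** * Ultrapowers *)

Local Open Scope quotient_scope.
Local Open Scope classical_set_scope.

Section Ultrapower.
Variables (A : zmodType) (U : set_system nat).
Context {UU : UltraFilter U}.

(** The ultrapower is the quotient of [nat -> A] by this subgroup. *)
Definition null : {pred nat -> A} := fun f => `[< U [set n | f n = 0] >].

Lemma null_zmod_closed : zmod_closed null.
Proof.
split=> [|f g /asboolP Uf /asboolP Ug]; apply/asboolP; first exact: filterE.
by apply: filterS2 Uf Ug => n /= fn gn; rewrite /GRing.add /GRing.opp/= fn gn oppr0 addr0.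
Qed.

HB.instance Definition _ := GRing.isZmodClosed.Build (nat -> A) null null_zmod_closed.

Definition ultrapower : zmodType := Quotient.quot null.

Definition ultra (f : nat -> A) : ultrapower := \pi_(Quotient.quot null) f.

Lemma ultra_eq f g : ultra f = ultra g <-> U [set n | f n = g n].
Proof.
split=> [/eqP|h].
  rewrite -Quotient.idealrBE => /asboolP; apply: filterS => n /= /subr0_eq; exact.
apply/eqP; rewrite -Quotient.idealrBE; apply/asboolP; apply: filterS h => n /= fg.
by rewrite /GRing.add /GRing.opp /= fg subrr.
Qed.

Lemma ultraD f g : ultra (fun n => f n + g n) = ultra f + ultra g.
Proof. exact: raddfD. Qed.

Lemma ultra_surj x : exists f, x = ultra f.
Proof. by exists (repr x); rewrite /ultra reprK. Qed.

(** Theorem of Los: negation rests on the ultrafilter property, the quantifier on witnesses chosen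
    coordinate by coordinate, with 0 where none exists. *)
Lemma los f (e : nat -> nat -> A) :
  sat (fun i => ultra (e i)) f <-> U [set n | sat (fun i => e i n) f].
Proof.
elim: f e => [t t'|f IH|f IHf g IHg|k f IH] e /=.
- have tE t0 : teval (fun i => ultra (e i)) t0 = ultra (fun n => teval (fun i => e i n) t0).
    by elim: t0 => [//|t1 IH1 t2 IH2] /=; rewrite IH1 IH2 ultraD.
  by rewrite !tE ultra_eq.
- rewrite IH; split=> [nU|Un Uf].
    by have [|] := in_ultra_setVsetC [set n | sat (fun i => e i n) f] UU.
  by have [n []] := filter_ex (filterI Un Uf).
- rewrite IHf IHg; split=> [[Uf Ug]|Ufg]; first exact: filterI.
  by split; apply: filterS Ufg => n [].
- have updE x : upd (fun i => ultra (e i)) k (ultra x) = fun i => ultra (upd e k x i).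
    by apply/funext => i; rewrite /upd; case: eqP.
  have updnE x n : (fun i => upd e k x i n) = upd (fun i => e i n) k (x n).
    by apply/funext => i; rewrite /upd; case: eqP.
  split=> [[b]|Ub].
    have [x ->] := ultra_surj b; rewrite updE IH; apply: filterS => n /=.
    by rewrite updnE; exists (x n).
  have /choice[x xP] : forall n, exists b,
      (exists b, sat (upd (fun i => e i n) k b) f) -> sat (upd (fun i => e i n) k b) f.
    move=> n; have [[b bf]|no] := pselect (exists b, sat (upd (fun i => e i n) k b) f).
      by exists b.
    by exists 0 => /no.
  exists (ultra x); rewrite updE IH; apply: filterS Ub => n /= /xP.
  by rewrite updnE.
Qed.

Lemma ultrapower_elem_equiv : elem_equiv A ultrapower.
Proof.
move=> f; split=> [Af e|Uf e].
  have /choice[e' e'E] := fun i => ultra_surj (e i).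
  have -> : e = fun i => ultra (e' i) by apply/funext.
  by apply/los/filterE => n; exact: Af.
have /los := Uf (fun i => ultra (fun=> e i)).
by move=> /filter_ex[].
Qed.

End Ultrapower.

(** * Dp-smallness *)

Lemma elem_equiv_refl (A : zmodType) : elem_equiv A A.
Proof. by []. Qed.

Lemma inst_coset (M : zmodType) s (x y : M) :
  inst (fpp (ppin s ('X^0 - 'X^1))) (fun=> y) x <-> pp_of s (x - y).
Proof. by rewrite /inst sat_fpp ppsat_ppin linB !linX. Qed.

Lemma dp_small_minimal (A : zmodType) : dp_small A -> dp_minimal A.
Proof.
by move=> small [M [phi [psi [a [b pat]]]]]; apply: small; exists M, (fun=> phi), a, psi, b.
Qed.

(** If both failed, take [b j] in [s] pairwise distinct modulo [t], and [a i] in [t] pairwise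
    distinct modulo [s]. The sums [a i + b j] realize the forbidden grid of cosets. *)
Lemma dp_minimal_total (A : zmodType) (s t : seq (int * int)) : dp_minimal A ->
  precsim (pp_of (A := A) s) (pp_of t) \/ precsim (pp_of (A := A) t) (pp_of s).
Proof.
move=> dpm; apply: contrapT => /not_orP[st ts]; apply: dpm.
have [b [sb tb]] := not_precsim_seq (pp_of_subgroup A s) (pp_of_subgroup A t) st.
have [a [ta sa]] := not_precsim_seq (pp_of_subgroup A t) (pp_of_subgroup A s) ts.
exists A, (fpp (ppin s ('X^0 - 'X^1))), (fpp (ppin t ('X^0 - 'X^1))),
  (fun i _ => a i), (fun j _ => b j).
split=> [|i0 j0]; first exact: elem_equiv_refl.
exists (a i0 + b j0); split.
- by apply/inst_coset; rewrite addrAC subrr add0r.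
- by apply/inst_coset; rewrite addrK.
- move=> i ne /inst_coset; rewrite addrAC => h; apply: (sa i0 i); first by move=> e; apply: ne.
  by rewrite -[_ - _](addrK (b j0)); apply: (pp_of_subgroup A s).2.
- move=> j ne /inst_coset; rewrite -addrA => h; apply: (tb j0 j); first by move=> e; apply: ne.
  by rewrite -[_ - _](addKr (a i0)) addrC; apply: (pp_of_subgroup A t).2.
Qed.

(** * Finite combinatorics of an ultrafilter *)

Section FiniteFilters.
Variables (T : Type) (U : set_system T).
Context {UU : UltraFilter U}.

Lemma filter_all_in (I : eqType) (s : seq I) (P : I -> set T) :
  (forall i, i \in s -> U (P i)) -> U [set j | forall i, i \in s -> P i j].
Proof.
elim: s => [_|i s IH h]; first exact: filterE.
have Us : U [set j | forall i, i \in s -> P i j].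
  by apply: IH => k sk; apply: h; rewrite inE sk orbT.
apply: filterS2 (h i (mem_head _ _)) Us => j Pij Ps k.
by rewrite inE => /predU1P[->//|/Ps].
Qed.

Lemma ultra_pigeonhole (I : eqType) (s : seq I) (P : I -> set T) :
  U [set j | exists2 i, i \in s & P i j] -> exists2 i, i \in s & U (P i).
Proof.
move=> Us; apply: contrapT => no.
have /(filterI Us)/filter_ex[j [[i si Pij] /(_ i si)]] :
    U [set j | forall i, i \in s -> ~ P i j]; last exact.
apply: filter_all_in => i si.
by have [Pi|//] := in_ultra_setVsetC (P i) UU; case: no; exists i.
Qed.

End FiniteFilters.

Lemma free_ultrafilter : exists U : set_system nat,
  UltraFilter U /\ forall N, U [set n | (N <= n)%N].
Proof.
have [U [UU sub]] := ultraFilterLemma eventually_filter.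
by exists U; split=> // N; apply: sub; exists N.
Qed.

(** * Coherence excludes a dp-small pattern *)

Section Smallness.
Variable M : zmodType.
Hypothesis good : forall s, exists t,
  [/\ precsim (pp_of (A := M) s) (pp_of t),
      (forall x : M, pp_of t x -> pp_of s x) &
      forall u, precsim (pp_of (A := M) u) (pp_of t) \/
        forall x : M, pp_of t x -> pp_of u x].

Lemma no_dp_small_pattern (theta : nat -> formula) (c : nat -> nat -> M)
    (psi : formula) (b : nat -> nat -> M) :
  ~ forall i0 j0 : nat, exists x : M,
    [/\ inst (theta i0) (c i0) x, inst psi (b j0) x,
        (forall i, i <> i0 -> ~ inst (theta i) (c i) x) &
        (forall j, j <> j0 -> ~ inst psi (b j) x)].
Proof.
move=> pat; have [x' xP'] := choice (fun ij : nat * nat => pat ij.1 ij.2).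
pose x i j := x' (i, j); have {}xP' i j := xP' (i, j).
have xP i j : [/\ inst (theta i) (c i) (x i j), inst psi (b j) (x i j),
    (forall i', i' <> i -> ~ inst (theta i') (c i') (x i j)) &
    (forall j', j' <> j -> ~ inst psi (b j') (x i j))] by exact: xP'.
have [U [UU Uinf]] := free_ultrafilter.
have [ps psP] := @sat_same_pp M psi.
pose H p : M -> Prop := ppgroup 0 p; pose D j p : M -> Prop := fiber (b j) 0 p.
have sH p : subgroup (H p) by exact: ppgroup_subgroup.
have cD j p : coset_like (H p) (D j p) by exact: fiber_coset.
have HE p : pp_of (ppgroup_form p) = H p.
  by apply/funext => y; apply/propext; exact: pp_of_ppgroup_form.
(* [k p] describes the shrunk subgroup [K p] of finite index in [H p]: every [H q] either contains
   it or is finite modulo it. *)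
have /choice[k kP] : forall p, exists t,
  [/\ precsim (H p) (pp_of t), (forall x : M, pp_of t x -> H p x) &
      forall q, precsim (H q) (pp_of t) \/ forall x : M, pp_of t x -> H q x].
  move=> p; have [t [t1 t2 t3]] := good (ppgroup_form p); rewrite HE in t1 t2.
  by exists t; split=> // q; have := t3 (ppgroup_form q); rewrite HE.
pose K p : M -> Prop := pp_of (k p).
have sK p : subgroup (K p) by exact: pp_of_subgroup.
have KH p y : K p y -> H p y by have [_ h _] := kP p; exact: h.
have /choice[S SP] : forall p, exists S : seq M,
    forall y, H p y -> exists2 g, g \in S & K p (y - g).
  move=> p; have [[S [_ SP]] _ _] := kP p; exists S => y /SP[g Sg [_ Kg]].
  by exists g.
(* Row [i] leaves every coset of [H p]; otherwise it is almost constant mod [H p]. *)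
pose esc i p := forall g, U [set j | ~ H p (x i j - g)].
have /choice[g0 g0P] : forall ip, exists g,
    ~ esc ip.1 ip.2 -> U [set j | H ip.2 (x ip.1 j - g)].
  move=> [i p]; have [ei|/existsNP[g ng]] := pselect (esc i p); first by exists 0.
  exists g => _; have [//|] := in_ultra_setVsetC [set j | H p (x i j - g)] UU.
  by move=> /ng.
pose g i p := g0 (i, p).
have gP i p : ~ esc i p -> U [set j | H p (x i j - g i p)] by exact: (g0P (i, p)).
(* [Q] lists the possible labels of a row: a formula [p] and a [K p]-coset in [H p]. Taking one row
   more than labels forces two rows to share one. *)
pose Q := [seq (p, h) | p <- ps, h <- S p].
pose rows := iota 0 (size Q).+1.
have Ugood : U [set j | forall i, i \in rows -> forall p, p \in ps ->
    ~ esc i p -> H p (x i j - g i p)].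
  apply: filter_all_in => i _; apply: filter_all_in => p _.
  have [ei|/gP Ug] := pselect (esc i p); first by apply: filterE => j.
  by apply: filterS Ug.
have D_sub j p y z : H p (y - z) -> D j p y -> D j p z by move=> Hyz Dy; exact/(cD _ _ _ Dy).
(* A fiber is empty or a single coset of [H p], so an escaping row is almost always outside it. *)
have D_esc j i p : esc i p -> U [set l | ~ D j p (x i l)].
  move=> ei; have [[a Da]|no] := pselect (exists a, D j p a).
    apply: filterS (ei a) => l /= nH /(cD _ _ _ Da)/(subgroup_sym (sH p)); exact: nH.
  by apply: filterE => l Dl; apply: no; exists (x i l).
(* Non-escaping fibers are almost constant along row [i], but [psi] separates
   [x i j] from the rest of the row. *)
have row_escape j i :
    (forall p, p \in ps -> ~ esc i p -> H p (x i j - g i p)) ->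
    exists2 p, p \in ps & esc i p /\ D j p (x i j).
  move=> jgood; apply: contrapT => no.
  have Usame : U [set l | forall p, p \in ps -> D j p (x i j) <-> D j p (x i l)].
    apply: filter_all_in => p psp; have [ei|nei] := pselect (esc i p).
      apply: filterS (D_esc j i p ei) => l nD; split=> // Dj.
      by case: no; exists p.
    apply: filterS (gP i p nei) => l Hl.
    have Hjl : H p (x i j - x i l).
      exact: (@subgroup_trans _ _ (g i p) _ _ (sH p) (jgood p psp nei) (subgroup_sym (sH p) Hl)).
    by split; apply: D_sub => //; exact: (subgroup_sym (sH p) Hjl).
  have [l [lt_jl same]] := filter_ex (filterI (Uinf j.+1) Usame).
  have [_ psi_j _ _] := xP i j; have [_ _ _ /(_ j)] := xP i l; apply.
    by move=> jl; rewrite jl /= ltnn in lt_jl.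
  exact: psP same psi_j.
(* The base point of a fiber is chosen independently of the row, which makes the labels of different
   rows in one column comparable. *)
have /choice[a aP] : forall jp, exists a, forall y, D jp.1 jp.2 y -> D jp.1 jp.2 a.
  move=> [j p]; have [[a Da]|no] := pselect (exists a, D j p a); first by exists a.
  by exists 0 => y Dy; case: no; exists y.
pose col j i (ph : ppform * M) := esc i ph.1 /\ K ph.1 (a (j, ph.1) - x i j - ph.2).
pose pairs := [seq (ii, p) | ii <- [seq (i, i') | i <- rows, i' <- rows], p <- ps].
have Upair : U [set j | exists2 r, r \in pairs &
    r.1.1 <> r.1.2 /\ esc r.1.1 r.2 /\ K r.2 (x r.1.1 j - x r.1.2 j)].
  apply: filterS Ugood => j jgood; apply: contrapT => no.
  have /choice[f fP] : forall i, exists ph, i \in rows -> ph \in Q /\ col j i ph.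
    move=> i; have [ri|] := boolP (i \in rows); last by exists ([::], 0).
    have [p psp [ei Dp]] := row_escape j i (jgood i ri).
    have /SP[h Sh Kh] : H p (a (j, p) - x i j).
      by apply/(cD j p _ (aP (j, p) _ Dp)).
    by exists (p, h) => _; split=> //; apply/allpairsPdep; exists p, h.
  have f_inj : {in rows &, injective f}.
    move=> i i' ri ri' ff'; apply: contrapT => ne; apply: no.
    have [/allpairsPdep[p [h [psp _ fE]]] [ei Ki]] := fP i ri.
    have [_ [_ Ki']] := fP i' ri'; rewrite -ff' in Ki'.
    exists ((i, i'), p); first by apply: allpairs_f => //; exact: allpairs_f.
    rewrite fE /= in ei Ki Ki'; split=> //; split=> //=.
    have := (sK p).2 _ _ Ki' Ki; congr (K p _).
    by rewrite opprB subrKA opprB addrC subrKA.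
  have : (size (map f rows) <= size Q)%N.
    apply: uniq_leq_size; first by rewrite map_inj_in_uniq ?iota_uniq.
    by move=> _ /mapP[i /fP[Qf _] ->].
  by rewrite size_map size_iota ltnn.
(* There are finitely many triples, so one pair of rows and one [p] serve for almost all columns
   [j]. *)
have [[[i i'] p] _ Uii] := ultra_pigeonhole Upair.
have [_ [/= ne [ei _]]] := filter_ex Uii.
have {}Uii : U [set j | K p (x i j - x i' j)] by apply: filterS Uii => j [_ []].
have [ts tsP] := @sat_same_pp M (theta i).
have : U [set j | forall q, q \in ts -> fiber (c i) 0 q (x i j) <-> fiber (c i) 0 q (x i' j)].
  apply: filter_all_in => q _.
  have cq := @fiber_coset M (c i) 0 q.
  (* If [K p] lies in [H q], both points are in the same [H q]-coset. In the other case a nonempty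
     fiber meets finitely many [K p]-cosets; row [i] leaves them all, since [K p] lies in [H p], and
     row [i'] does so with it. *)
  have [_ _ /(_ q)[[s [_ sP]]|KHq]] := kP p; last first.
    apply: filterS Uii => j /KHq Hq; split=> Dj; apply/(cq _ Dj) => //.
    exact: (subgroup_sym (sH q)).
  have [[d Dd]|no] := pselect (exists d, fiber (c i) 0 q d); last first.
    by apply: filterE => j; split=> Dj; case: no; [exists (x i j)|exists (x i' j)].
  have Us : U [set j | forall h, h \in s -> ~ K p (d - x i j - h)].
    apply: filter_all_in => h _; apply: filterS (ei (d - h)) => j nH /KH/(subgroupN (sH p)) Hd.
    by apply: nH; move: Hd; congr (H p _); rewrite !opprB addrCA.
  apply: filterS2 Us Uii => j nK Kii; split=> /(cq _ Dd)/sP[h sh [_ Kh]]; case: (nK h sh) => //.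
  by have := (sK p).2 _ _ Kh Kii; congr (K p _); rewrite opprB addrAC subrKA.
move=> /filter_ex[j same]; have [th _ _ _] := xP i j.
have [_ _ /(_ i) nth _] := xP i' j; apply: nth => //.
exact: tsP same th.
Qed.

End Smallness.

(** [r] is a coherent representative of the class of [s], and [s ++ r] cuts it down into [s]. By
    totality, a subgroup [u] that is not [precsim] to [r] is strictly above [r], so coherence puts
    [r] inside [u]. *)
Lemma coherent_subgroup (A : zmodType) : dp_minimal A -> upwardly_coherent A ->
  forall s, exists t,
  [/\ precsim (pp_of (A := A) s) (pp_of t),
      (forall x : A, pp_of t x -> pp_of s x) &
      forall u, precsim (pp_of (A := A) u) (pp_of t) \/
        forall x : A, pp_of t x -> pp_of u x].
Proof.
move=> dpm coh s; have sP (u : seq (int * int)) := @pp_of_subgroup A u.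
have [|B [[r BE] [rs sr] up]] := coh (pp_of s); first by exists s.
have {BE}BE : B = pp_of r by apply/funext => y; apply/propext.
subst B; exists (s ++ r).
have -> : pp_of (A := A) (s ++ r) = fun x => pp_of s x /\ pp_of r x.
  by apply/funext => x; apply/propext; exact: pp_of_cat.
split=> [|x []//|u]; first by apply: precsim_capB => //; exact: precsim_sub.
have [ur|nur] := pselect (precsim (pp_of u) (pp_of (A := A) r)).
  by left; apply: precsim_capB => //; exact: precsim_trans rs.
right=> x [_ rx]; have [//|ru] := dp_minimal_total u r dpm.
by apply: up ru nur x rx; exists u.
Qed.

(** Coherence speaks of [A] while the pattern lives in a model [M]; the inclusions and finite
    indices given by [coherent_subgroup] transfer to [M]. *)
Lemma dp_small_of_coherent (A : zmodType) :
  dp_minimal A -> upwardly_coherent A -> dp_small A.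
Proof.
move=> dpm coh [M [theta [c [psi [b [AM pat]]]]]]; apply: no_dp_small_pattern pat => s.
have [t [st ts tu]] := coherent_subgroup dpm coh s; exists t; split.
- exact: precsim_transfer st.
- exact: pp_of_sub_transfer ts.
- by move=> u; case: (tu u) => [/(precsim_transfer AM)|/(pp_of_sub_transfer AM)]; [left|right].
Qed.

(** * Failure of coherence yields a dp-small pattern in an ultrapower *)

Lemma los_inst (A : zmodType) (U : set_system nat) (UU : UltraFilter U) f
    (e : nat -> nat -> A) (x : nat -> A) :
  inst f (fun i => ultra (UU := UU) (e i)) (ultra (UU := UU) x) <->
  U [set n | inst f (fun i => e i n) (x n)].
Proof.
have -> : inst f (fun i => ultra (UU := UU) (e i)) (ultra (UU := UU) x) <->
    sat (fun i => ultra (UU := UU) (upd e 0 x i)) f.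
  by rewrite /inst (_ : upd _ _ _ = fun i => ultra (UU := UU) (upd e 0 x i)) //;
    apply/funext => i; rewrite /upd; case: eqP.
rewrite los; set P := [set _ | _]; set P' := [set _ | _].
by suff -> : P = P' by []; apply/seteqP; split=> n; rewrite /P /P' /inst /=;
  congr sat; apply/funext => i; rewrite /upd; case: eqP.
Qed.

Lemma dp_small_coherent (A : zmodType) : dp_small A -> upwardly_coherent A.
Proof.
move=> small B' [s' /(_ _)/propext B'E].
have {B'E}-> : B' = pp_of s' by apply/funext.
have tot s t := dp_minimal_total s t (dp_small_minimal small).
have sP (u : seq (int * int)) := @pp_of_subgroup A u.
apply: contrapT => no.
(* [T s] is strictly above [s] up to finite index and yet fails to contain it; outside the class of
   [s'] it is set to [[::]]. *)
have /choice[T TP] : forall s, exists t, simeq (pp_of s) (pp_of (A := A) s') ->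
    [/\ precsim (pp_of (A := A) s) (pp_of t), ~ precsim (pp_of (A := A) t) (pp_of s) &
        exists x : A, pp_of s x /\ ~ pp_of t x].
  move=> s; have [ss'|] := pselect (simeq (pp_of s) (pp_of (A := A) s')); last by exists [::].
  apply: contrapT => nt; apply: no; exists (pp_of s); split=> //; first by exists s.
  move=> B1 [t B1E] sB1 B1s x sx; have BE : B1 = pp_of t by apply/funext => y; apply/propext.
  apply: contrapT => nB1x; apply: nt; exists t => _; rewrite -BE; split=> //.
  by exists x.
(* From the whole group [c 0] on, each stage intersects with the failure of coherence at
   [s' ++ c n], a subgroup still in the class of [s'] by [sg_sim]. *)
pose c := fix c n := if n is n'.+1 then c n' ++ T (s' ++ c n') else [::].
pose sg n := s' ++ c n.
have catE (s t : seq (int * int)) : pp_of (A := A) (s ++ t) = fun x => pp_of s x /\ pp_of t x.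
  by apply/funext => x; apply/propext; exact: pp_of_cat.
have sgS n : pp_of (A := A) (sg n.+1) = fun x => pp_of (sg n) x /\ pp_of (T (sg n)) x.
  by rewrite /sg /= catA catE.
have sg_sim n : simeq (pp_of (sg n)) (pp_of (A := A) s').
  elim: n => [|n IH]; first by rewrite /sg cats0; split; exact: precsim_sub.
  split; first by apply: precsim_sub => // x; rewrite /sg catE => -[].
  have [T1 _ _] := TP _ IH; apply: precsim_trans (IH.2) _ => //.
  by rewrite sgS; apply: precsim_capB => //; exact: precsim_sub.
(* By totality, one of [c n] and [T (sg n)] is finite modulo the other, hence modulo their
   intersection [c n.+1]; were the latter finite modulo [s'], that one would be too. *)
have c_large n : ~ precsim (pp_of (A := A) (c n)) (pp_of s').
  elim: n => [|n IH] h.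
    have [_ + _] := TP _ (sg_sim 0%N); apply.
    apply: precsim_trans (sg_sim 0%N).2 => //; apply: precsim_trans h => //.
    exact: precsim_sub.
  have [_ nT _] := TP _ (sg_sim n); have cT := tot (c n) (T (sg n)).
  rewrite /= catE in h; case: cT => cT.
    by apply: IH; apply: precsim_trans h => //; apply: precsim_capB => //; exact: precsim_sub.
  apply: nT; apply: precsim_trans (sg_sim n).2 => //; apply: precsim_trans h => //.
  by apply: precsim_capB => //; exact: precsim_sub.
have c_anti m n x : (m <= n)%N -> pp_of (c n) x -> pp_of (A := A) (c m) x.
  elim: n => [|n IH]; first by rewrite leqn0 => /eqP->.
  by rewrite leq_eqVlt => /predU1P[->//|/IH h]; rewrite /= catE => -[/h].
have /choice[x xP] : forall n, exists x : A, pp_of (sg n) x /\ ~ pp_of (T (sg n)) x.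
  by move=> n; have [] := TP _ (sg_sim n).
have /choice[b bP] : forall N, exists b : nat -> A, (forall j, pp_of (c N) (b j)) /\
    forall j l, j <> l -> ~ pp_of s' (b j - b l).
  by move=> N; exact: not_precsim_seq.
(* For [i < N], adding [b N j] from [c N], which lies inside [c i.+1], keeps [x i] in its layer. *)
have layer N i j i' : (i < N)%N ->
    (pp_of (c i') (b N j + x i) /\ ~ pp_of (c i'.+1) (b N j + x i)) <-> i' = i.
  move=> lt_iN; have [bc _] := bP N.
  have cx : pp_of (c i) (x i) by have [+ _] := xP i; rewrite /sg catE => -[].
  have ci : pp_of (c i) (b N j + x i).
    by apply: (subgroupD (sP (c i))) => //; apply: c_anti (bc j); exact: ltnW.
  have nci : ~ pp_of (c i.+1) (b N j + x i).
    move=> h; have [_] := xP i; apply.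
    have : pp_of (c i.+1) (x i).
      rewrite -[x i](addKr (b N j)) addrC; apply: (sP _).2 => //.
      exact: c_anti (bc j).
    by rewrite /= catE => -[].
  split=> [[h nh]|->]; last by split.
  have [lt|lt|//] := ltngtP i' i.
    by case: nh; exact: c_anti ci.
  by case: nci; exact: c_anti h.
have [U [UU Uinf]] := free_ultrafilter.
apply: small; exists (@ultrapower A U UU),
  (fun i => FAnd (fpp (ppin (c i) 'X^0)) (FNeg (fpp (ppin (c i.+1) 'X^0)))),
  (fun _ _ => ultra (UU := UU) (fun=> 0)), (fpp (ppin s' ('X^0 - 'X^1))),
  (fun j _ => ultra (UU := UU) (fun N => b N j)).
split; first exact: ultrapower_elem_equiv.
have inst_layer i y : inst (FAnd (fpp (ppin (c i) 'X^0)) (FNeg (fpp (ppin (c i.+1) 'X^0))))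
    (fun=> 0) y <-> pp_of (A := A) (c i) y /\ ~ pp_of (A := A) (c i.+1) y.
  have instE u : inst (fpp (ppin u 'X^0)) (fun=> 0) y <-> pp_of (A := A) u y.
    by rewrite /inst sat_fpp ppsat_ppin linX.
  by rewrite -!instE.
have Unot (P Q : set nat) : U P -> P `<=` ~` Q -> ~ U Q.
  by move=> UP PQ UQ; have [n [/PQ]] := filter_ex (filterI UP UQ).
(* The layers are correct in every coordinate [N > i0], hence almost everywhere since [U] is
   free. *)
move=> i0 j0; exists (ultra (UU := UU) (fun N => b N j0 + x i0)); split.
- apply/los_inst; apply: filterS (Uinf i0.+1) => N /= lt_iN.
  exact/inst_layer/layer.
- apply/los_inst/filterE => N /=; apply/inst_coset; rewrite addrAC subrr add0r.
  by have [+ _] := xP i0; rewrite /sg catE => -[].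
- move=> i ne /los_inst; apply: Unot (Uinf i0.+1) _ => N /= lt_iN.
  by move=> /inst_layer/(layer _ _ _ _ lt_iN).
- move=> j ne /los_inst; apply: Unot (Uinf 0%N) _ => N _ /= /inst_coset.
  have [_ bs'] := bP N; move=> h; apply: (bs' j0 j); first by move=> e; apply: ne.
  have : pp_of s' (x i0) by have [+ _] := xP i0; rewrite /sg catE => -[].
  by move=> /((sP s').2 _ _ h); congr (pp_of s' _); rewrite addrAC addrK.
Qed.

Theorem theorem1p6 (A : zmodType) :
  dp_small A <-> (dp_minimal A /\ upwardly_coherent A).
Proof.
split=> [small|[dpm coh]]; last exact: dp_small_of_coherent.
by split; [exact: dp_small_minimal|exact: dp_small_coherent].
Qed.
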